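(* Let $G=\langle s_1,\ldots,s_r\rangle$ be a free group or free semigroup of rank $r\ge 1$, let $T=(T_g)_{g\in G}$ be a measure-preserving action of $G$ on a standard probability space $(X,\mu)$, and let $\phi:X\to A$ be a finite observable. For each $i\ge 1$ let $\sigma_i:G\to\mathrm{Sym}(i)$ be a homomorphism chosen uniformly at random among all homomorphisms from $G$ to $\mathrm{Sym}(i)$. Then $$F(T,\phi)=\inf_{\epsilon>0}\lim_{i\to\infty}\frac1i\log\Big(\mathbb E\Big[\big|\{\psi:\{1,\ldots,i\}\to A:\ d^*_{\sigma_i}(\phi,\psi)\le\epsilon\}\big|\Big]\Big).$$
   Context: Semigroups have an identity element $e$ (so a free semigroup of rank $r$ is the free monoid on $s_1,\dots,s_r$), and homomorphisms and actions respect the identity. $\mathrm{Sym}(n)$ is the symmetric group of $\{1,\ldots,n\}$. A measure-preserving action $T=(T_g)_{g\in G}$ of $G$ on $(X,\mu)$ consists of measure-preserving maps $T_g:X\to X$ with $T_{g_1}T_{g_2}=T_{g_1g_2}$. A finite observable is a measurable map $\phi:X\to A$ with $A$ a finite set. $\mathbb E$ denotes expectation over the random $\sigma_i$. For finite $H\subset G$ let $\phi^H:X\to A^H$ be $\phi^H(x)=(\phi(T_hx))_{h\in H}$, with pushforward measure $\phi^H_*\mu$ on $A^H$. Given a homomorphism $\sigma:G\to\mathrm{Sym}(n)$ and a map $\psi:\{1,\ldots,n\}\to A$, let $\psi^H(j)=(\psi(\sigma(h)j))_{h\in H}$, and let $\psi^H_*\zeta$ be the pushforward to $A^H$ of the uniform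 probability measure $\zeta$ on $\{1,\dots,n\}$. Put $$d^H_{\sigma}(\phi,\psi)=\sum_{a\in A^H}\big|\phi^H_*\mu(a)-\psi^H_*\zeta(a)\big|,\qquad d^*_\sigma(\phi,\psi)=\sum_{j=1}^r d^{\{e,s_j\}}_\sigma(\phi,\psi).$$ For a countable measurable partition $\alpha$ of $X$, $H(\alpha)=-\sum_{P\in\alpha}\mu(P)\log\mu(P)$ (with $0\log 0=0$), $\alpha\vee\beta=\{P\cap Q:P\in\alpha,Q\in\beta\}$, and $$F(T,\alpha)=(1-2r)H(\alpha)+\sum_{i=1}^rH(\alpha\vee T_{s_i}^{-1}\alpha).$$ For an observable $\phi:X\to A$, $F(T,\phi):=F(T,\bar\phi)$ where $\bar\phi=\{\phi^{-1}(a)\}_{a\in A}$. *)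

(* Defs.v *)
From HB Require Import structures.
From mathcomp Require Import all_boot all_order all_algebra all_fingroup.
From mathcomp Require Import finmap.
From mathcomp Require Import all_classical all_reals all_analysis.
Import Order.TTheory GRing.Theory Num.Theory.
Import numFieldNormedType.Exports.

Set Implicit Arguments.
Unset Strict Implicit.
Unset Printing Implicit Defensive.

Local Open Scope classical_set_scope.
Local Open Scope ring_scope.

(* A semigroup with identity is a monoidType; freeness is the universal
   property in the category of monoids, resp. of groups. *)
Definition free_semigroup_on (r : nat) (G : monoidType) (s : 'I_r -> G) : Prop :=
  forall (M : monoidType) (f : 'I_r -> M),
    exists! h : G -> M, monoid.monoid_morphism h /\ (forall i, h (s i) = f i).

Definition free_group_on (r : nat) (G : monoidType) (s : 'I_r -> G) : Prop :=
  (forall g : G, exists g' : G, (g * g' = 1 /\ g' * g = 1)%g) /\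
  (forall (M : groupType) (f : 'I_r -> M),
    exists! h : G -> M, monoid.monoid_morphism h /\ (forall i, h (s i) = f i)).

(* X is Borel isomorphic to a Polish space P; a complete Hausdorff
   pseudometric space is a complete metric space, and for metrizable spaces
   second countability is separability. *)
Definition standard_borel (R : realType) (d : measure_display)
    (X : measurableType d) : Prop :=
  exists (P : completePseudoMetricType R) (f : X -> P),
    [/\ hausdorff_space P, @second_countable P, bijective f &
        forall B : set P, <<s @open P >> B <-> measurable (f @^-1` B)].

Section actions_and_observables.
Context (R : realType) (d : measure_display) (X : measurableType d).
Variable mu : probability X R.

Definition measure_preserving (t : X -> X) : Prop :=
  measurable_fun setT t /\
  forall B : set X, measurable B -> mu (t @^-1` B) = mu B.

Definition mp_action (G : monoidType) (T : G -> X -> X) : Prop :=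
  [/\ forall g, measure_preserving (T g),
      T 1%g = id &
      forall g1 g2, T (g1 * g2)%g = T g1 \o T g2].

Definition observable (A : finType) (phi : X -> A) : Prop :=
  forall B : set A, measurable (phi @^-1` B).

(* Partitions are sets of subsets of X. Empty cells, the only ones that can be
   repeated in the families below, contribute 0 to the entropy; ln 0 = 0, so
   0 log 0 = 0. *)
Definition entropy (alpha : set (set X)) : \bar R :=
  \esum_(P in alpha) (- (fine (mu P) * ln (fine (mu P))))%:E.

Definition pjoin (alpha beta : set (set X)) : set (set X) :=
  [set P `&` Q | P in alpha & Q in beta].

Definition ppreimage (t : X -> X) (alpha : set (set X)) : set (set X) :=
  [set t @^-1` P | P in alpha].

Definition observable_partition (A : finType) (phi : X -> A) : set (set X) :=
  [set phi @^-1` [set a] | a in [set: A]].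

Definition F_partition (r : nat) (G : monoidType) (s : 'I_r -> G)
    (T : G -> X -> X) (alpha : set (set X)) : \bar R :=
  ((1 - 2 * r%:R)%:E * entropy alpha
   + \sum_(i < r) entropy (pjoin alpha (ppreimage (T (s i)) alpha)))%E.

Definition F_observable (r : nat) (G : monoidType) (s : 'I_r -> G)
    (T : G -> X -> X) (A : finType) (phi : X -> A) : \bar R :=
  F_partition s T (observable_partition phi).

End actions_and_observables.

(* Stated pointwise because the product of permutations in MathComp composes
   from left to right, whereas that of Sym(n) composes from right to left. *)
Definition sym_hom (G : monoidType) (n : nat) (sigma : G -> {perm 'I_n}) : Prop :=
  (forall j, sigma 1%g j = j) /\
  (forall g h j, sigma (g * h)%g j = sigma g (sigma h j)).

(* Expectation for the uniform distribution on the homomorphisms from G to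
   Sym(n). They form a finite set when G is finitely generated as a monoid or
   as a group. *)
Definition expect_sym_hom (R : realType) (G : monoidType) (n : nat)
    (f : (G -> {perm 'I_n}) -> R) : R :=
  let homs : {fset G -> {perm 'I_n}} := fset_set [set sigma | sym_hom sigma] in
  (\sum_(sigma <- homs) f sigma) / #|` homs|%:R.

Section local_statistics.
Context (R : realType) (d : measure_display) (X : measurableType d).
Variable mu : probability X R.
Variables (G : monoidType) (T : G -> X -> X) (A : finType) (phi : X -> A).

Definition obs_name (H : {fset G}) (x : X) : {ffun H -> A} :=
  [ffun h : H => phi (T (val h) x)].

Definition model_name (n : nat) (sigma : G -> {perm 'I_n}) (psi : 'I_n -> A)
    (H : {fset G}) (j : 'I_n) : {ffun H -> A} :=
  [ffun h : H => psi (sigma (val h) j)].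

Definition dist (H : {fset G}) (n : nat) (sigma : G -> {perm 'I_n})
    (psi : 'I_n -> A) : R :=
  \sum_(a : {ffun H -> A})
    `| fine (mu (obs_name H @^-1` [set a]))
       - #|[pred j | model_name sigma psi H j == a]|%:R / n%:R |.

Definition dist_star (r : nat) (s : 'I_r -> G) (n : nat)
    (sigma : G -> {perm 'I_n}) (psi : 'I_n -> A) : R :=
  \sum_(j < r) dist [fset 1%g; s j]%fset sigma psi.

Definition num_models (r : nat) (s : 'I_r -> G) (eps : R) (n : nat)
    (sigma : G -> {perm 'I_n}) : nat :=
  #|[pred psi : {ffun 'I_n -> A} | dist_star s sigma psi <= eps]|.

(* Extended-real valued: lne 0 = -oo. The term i = 0 is irrelevant. *)
Definition growth_rate (r : nat) (s : 'I_r -> G) (eps : R) (i : nat) : \bar R :=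
  ((i%:R^-1)%:E *
   lne (expect_sym_hom (fun sigma : G -> {perm 'I_i} =>
          (num_models s eps sigma)%:R))%:E)%E.

End local_statistics.

(* Main.v *)
Require Import Defs.
From HB Require Import structures.
From mathcomp Require Import all_boot all_order all_algebra all_fingroup.
From mathcomp Require Import finmap.
From mathcomp Require Import all_classical all_reals all_analysis.
From mathcomp Require Import zify ring lra.
Import Order.TTheory GRing.Theory Num.Theory.
Import numFieldNormedType.Exports.

(** A homomorphism from [G] to the permutations of [n] points is an arbitrary
    choice of [r] permutations [pi_1, ..., pi_r], so the expectation counts the
    pairs of a name [psi] and a tuple [(pi_j)] for which the laws of
    [(psi, psi o pi_j)] are within [eps] of the laws [p_j] of
    [(phi, phi o T_{s_j})], divided by [n!^r].

    Sort these pairs by their joint types [N_j(a, b)], the number of points with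
    [psi = a] and [psi o pi_j = b]. All row and column sums of all the [N_j] are
    the level counts [c] of [psi]. Conversely, for matrices with these common
    margins there are [n! / prod c!] names with level counts [c]
    (card_level_count) and, for each name, [(prod c!)^2 / prod N_j!] permutations
    with joint type [N_j] (card_perm_joint_count); card_models is the product. By
    Stirling's formula the logarithm of [n!^(1-r) (prod c!)^(2r-1) / prod N_j!]
    is [n F(N/n) + O(log n)], where
    [F(q) = (1 - 2r) H(margin of q) + sum_j H(q_j)] (ln_card_models). This is
    where the coefficient [1 - 2r] comes from: one factor [prod c!] is lost for
    the choice of the name, and two are gained for each permutation.

    There are only polynomially many joint types, so the growth rate for a given
    [eps] is at most the supremum of [F] over the compact convex set of families
    [q] of couplings with common margins that are within [eps] of [p]
    (mean_models_upper). It is also at least this supremum: a near-optimal [q] is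
    first moved slightly towards [p], into the open [eps]-ball
    (mean_models_lower_max), and is then approximated by integer matrices with
    common margins (coupling_family_integer_approx). So the limit exists for each
    [eps] and is the supremum (mean_models_cvg). As [T] preserves the measure, [p]
    itself has common margins; hence all these suprema are at least [F(p)], and
    by continuity of [F] at [p] their infimum is [F(p)] (inf_max_F). *)

Set Implicit Arguments.
Unset Strict Implicit.
Unset Printing Implicit Defensive.

(** * Counting names and permutations of given joint type *)

Lemma sum_tuple_cons (B : finType) (n : nat) (F : n.+1.-tuple B -> nat) :
  \sum_(t : n.+1.-tuple B) F t =
  \sum_(b : B) \sum_(t : n.-tuple B) F [tuple of b :: t].
Proof.
rewrite pair_big /= (reindex (fun q : B * n.-tuple B => [tuple of q.1 :: q.2])) //=.
exists (fun t => (thead t, [tuple of behead t])) => [[b t] _|t _] /=.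
  by congr pair; apply: val_inj.
by rewrite [RHS]tuple_eta.
Qed.

Lemma prod_fact_pred (I : finType) (N : I -> nat) (i : I) : 0 < N i ->
  \prod_j (N j)`! = N i * \prod_j (N j - (j == i))`!.
Proof.
move=> Ni; rewrite (bigD1 i) //= [in RHS](bigD1 i) //= eqxx subn1.
rewrite -[in LHS](prednK Ni) factS prednK // -mulnA; congr (_ * (_ * _)).
by apply: eq_bigr => j /negbTE ->; rewrite subn0.
Qed.

(** The conditional multinomial formula. By induction on [s]: the letter [b] put
    below the first letter [a0] leaves a count matrix that is smaller by one at
    [(a0, b)], which accounts for the proportion [N (a0, b) / count a0] of the
    second words. *)
Lemma card_tuples_joint_count (A B : finType) (s : seq A) (N : A * B -> nat) :
  (forall a, \sum_b N (a, b) = count_mem a s) ->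
  #|[pred t : (size s).-tuple B | [forall p, count_mem p (zip s t) == N p]]|
    * \prod_p (N p)`! = \prod_a (count_mem a s)`!.
Proof.
elim: s N => [|a0 s IH] N hN.
  have N0 p : N p = 0.
    case: p => a b; apply/eqP; have /eqP := hN a.
    by rewrite sum_nat_eq0 => /forallP/(_ b).
  rewrite !big1 ?muln1 //; last by move=> p _; rewrite N0.
  rewrite (eq_card (B := predT)) ?card_tuple // => t.
  by rewrite !inE tuple0; apply/forallP => p; rewrite N0.
(* The count matrix that remains when the first letter is placed above b. *)
pose N' b p := N p - (p == (a0, b)).
(* Adding the column (a0, b) to the words adds one to the entry (a0, b). *)
have key b (t : (size s).-tuple B) :
    [forall p, count_mem p (zip (a0 :: s) (b :: t)) == N p]
    = (0 < N (a0, b)) && [forall p, count_mem p (zip s t) == N' b p].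
  apply/forallP/andP => [h|[h0 /forallP h] p].
    have h0 : 0 < N (a0, b) by rewrite -(eqP (h _)) /= eqxx.
    split=> //; apply/forallP => p; rewrite /N' -(eqP (h p)) /= [p == _]eq_sym.
    by rewrite addKn.
  rewrite /= (eqP (h p)) /N' [_ == p]eq_sym.
  by case: (p =P (a0, b)) => [->|_]; rewrite ?subn0 // subnKC.
rewrite -sum1_card big_mkcond sum_tuple_cons big_distrl /=.
under eq_bigr => b _.
  under eq_bigr => t _ do rewrite inE key.
  over.
have -> : \prod_a (count_mem a (a0 :: s))`!
    = (\sum_b N (a0, b)) * \prod_a (count_mem a s)`!.
  rewrite hN (prod_fact_pred (i := a0)) /= ?eqxx //; congr (_ * _).
  by apply: eq_bigr => a _; rewrite [a == _]eq_sym addKn.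
rewrite big_distrl /=; apply: eq_bigr => b _.
have [h0|] := ltnP 0 (N (a0, b)); last first.
  by rewrite leqn0 => /eqP ->; rewrite big1.
rewrite -big_mkcond sum1_card (prod_fact_pred h0) mulnCA; congr (_ * _).
apply: IH => a; apply/(@addnI (a0 == a)).
rewrite -[RHS]/(count_mem a (a0 :: s)) -hN.
case: eqP => [<-|ne]; last first.
  apply: eq_bigr => b' _; rewrite /N'; case: eqP => [[/esym //]|_].
  by rewrite subn0.
rewrite (bigD1 b) //= [in RHS](bigD1 b) //= {1}/N' eqxx subn1.
rewrite (eq_bigr (fun i => N (a0, i))) => [|b' /negbTE nb]; last first.
  by rewrite /N' xpair_eqE nb andbF subn0.
by rewrite addnA add1n prednK.
Qed.

Definition level_count (n : nat) (A : finType) (f : 'I_n -> A) (a : A) : nat :=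
  #|[pred k | f k == a]|.

(** The joint type of two words: a matrix of counts with margins [level_count f]
    and [level_count g]. *)
Definition joint_count (n : nat) (A B : finType) (f : 'I_n -> A) (g : 'I_n -> B) :
  A * B -> nat := level_count (fun k => (f k, g k)).

Lemma count_mktuple (n : nat) (A : finType) (f : 'I_n -> A) (a : A) :
  count_mem a (mktuple f) = level_count f a.
Proof.
rewrite /= count_map /level_count -sum1_card -sum1_count big_enum_cond /=.
by apply: eq_bigl => k; rewrite inE.
Qed.

Lemma zip_mktuple (n : nat) (A B : finType) (f : 'I_n -> A) (g : 'I_n -> B) :
  zip (mktuple f) (mktuple g) = mktuple (fun k => (f k, g k)).
Proof. by rewrite /=; elim: (enum _) => //= k s ->. Qed.

Lemma card_joint_count (n : nat) (A B : finType) (f : 'I_n -> A) (N : A * B -> nat) :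
  (forall a, \sum_b N (a, b) = level_count f a) ->
  #|[pred g : {ffun 'I_n -> B} | [forall p, joint_count f g p == N p]]|
    * \prod_p (N p)`! = \prod_a (level_count f a)`!.
Proof.
move=> hN; have hN' a : \sum_b N (a, b) = count_mem a (mktuple f).
  by rewrite count_mktuple.
have := card_tuples_joint_count hN'; rewrite size_tuple.
under [in RHS]eq_bigr => a _ do rewrite count_mktuple.
move=> <-.
congr (_ * _).
pose h (g : {ffun 'I_n -> B}) := mktuple g.
have hinj : injective h.
  move=> g g' /(congr1 (@tnth _ _)) E; apply/ffunP => k.
  by have := congr1 (@^~ k) E; rewrite !tnth_mktuple.
rewrite -(fintype.card_image hinj); apply: eq_card => t.
rewrite inE; apply/fintype.imageP/idP => [[g]|ht].
  move=> /forallP hg ->; apply/forallP => p.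
  by rewrite /h zip_mktuple count_mktuple; apply: hg.
exists [ffun k => tnth t k].
  apply/forallP => p; rewrite -(eqP (forallP ht p)).
  rewrite /joint_count -count_mktuple -zip_mktuple; apply/eqP; congr (count_mem _ (zip _ _)).
  by congr val; apply: eq_from_tnth => k; rewrite tnth_mktuple ffunE.
by apply: eq_from_tnth => k; rewrite tnth_mktuple ffunE.
Qed.

(** The multinomial coefficient is the case of card_joint_count in which the
    conditioning word is constant. *)
Lemma card_level_count (n : nat) (A : finType) (c : A -> nat) :
  \sum_a c a = n ->
  #|[pred f : {ffun 'I_n -> A} | [forall a, level_count f a == c a]]|
    * \prod_a (c a)`! = n`!.
Proof.
move=> hc; pose u (k : 'I_n) := tt.
have lu x : level_count u x = n.
  by case: x; rewrite /level_count (eq_card (B := predT)) ?card_ord.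
have H a : \sum_b c b = level_count u a by rewrite lu.
have := card_joint_count (N := fun p => c p.2) H.
under [in RHS]eq_bigr => x _ do rewrite lu.
rewrite [RHS]big_const card_unit /= muln1 => <-; congr (_ * _); last first.
  rewrite -(pair_bigA _ (fun (x : unit) a => (c a)`!)) /=.
  by rewrite big_const card_unit /= muln1.
apply: eq_card => f; rewrite !inE.
have E x a : joint_count u f (x, a) = level_count f a.
  by apply: eq_card => k; rewrite !inE; case: x.
apply/forallP/forallP => h; last by move=> a; have := h (tt, a); rewrite E.
by case=> x a; rewrite E.
Qed.

Lemma level_count_perm (n : nat) (A : finType) (f g : 'I_n -> A) :
  level_count f =1 level_count g -> exists s : {perm 'I_n}, forall k, f (s k) = g k.
Proof.
move=> h; have : perm_eq (mktuple g) (mktuple f).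
  by apply/allP => a _ /=; apply/eqP; rewrite -!/(count_mem a _) !count_mktuple h.
case/tuple_permP => s /val_inj E; exists s => k.
by have := congr1 (fun t => tnth t k) E; rewrite !tnth_mktuple.
Qed.

Lemma level_count_comp_perm (n : nat) (A : finType) (f : 'I_n -> A) (s : {perm 'I_n}) :
  level_count (f \o s) =1 level_count f.
Proof.
move=> a; rewrite /level_count -!sum1_card [RHS](reindex_inj (@perm_inj _ s)).
exact: eq_bigl.
Qed.

Lemma sum_level_count (n : nat) (A : finType) (f : 'I_n -> A) :
  \sum_a level_count f a = n.
Proof.
rewrite -[RHS]card_ord -sum1_card (partition_big f predT) //=.
by apply: eq_bigr => a _; rewrite sum1_card; apply: eq_card => k; rewrite !inE.
Qed.

Lemma sum_joint_countl (n : nat) (A B : finType) (f : 'I_n -> A) (g : 'I_n -> B) a :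
  \sum_b joint_count f g (a, b) = level_count f a.
Proof.
rewrite /level_count -sum1_card (partition_big g predT) //=.
apply: eq_bigr => b _; rewrite sum1_card; apply: eq_card => k.
by rewrite !inE xpair_eqE.
Qed.

Lemma sum_joint_countr (n : nat) (A B : finType) (f : 'I_n -> A) (g : 'I_n -> B) b :
  \sum_a joint_count f g (a, b) = level_count g b.
Proof.
rewrite /level_count -sum1_card (partition_big f predT) //=.
apply: eq_bigr => a _; rewrite sum1_card; apply: eq_card => k.
by rewrite !inE xpair_eqE andbC.
Qed.

(** The permutations carrying [f] to [g] form a coset of the stabiliser of [f];
    comparing [n!] with the number of words in the orbit of [f] gives the order of
    this stabiliser. *)
Lemma card_perm_comp_eq (n : nat) (A : finType) (f g : 'I_n -> A) :
  level_count f =1 level_count g ->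
  #|[pred s : {perm 'I_n} | [forall k, f (s k) == g k]]|
    = \prod_a (level_count f a)`!.
Proof.
pose K (h : 'I_n -> A) := #|[pred s : {perm 'I_n} | [forall k, f (s k) == h k]]|.
have K_const h : level_count f =1 level_count h -> K h = K f.
  case/level_count_perm => s0 hs0; rewrite /K -!sum1_card.
  rewrite (reindex_inj (mulgI s0)) /=; apply: eq_bigl => s.
  rewrite !inE; apply/forallP/forallP => hs k.
    by have := hs ((s0^-1)%g k); rewrite permM -hs0 !permKV.
  by rewrite permM (eqP (hs _)) hs0.
move=> /K_const; rewrite -/(K g) => ->.
have := card_level_count (sum_level_count f).
set M := #|_| => MF.
(* Every permutation carries f to exactly one word with the level counts of f. *)
have: M * K f = n`!.
  rewrite -card_Sn -sum1_card.
  rewrite (partition_big (fun s : {perm 'I_n} => [ffun k => f (s k)])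
    [pred h : {ffun 'I_n -> A} | [forall a, level_count h a == level_count f a]])
    => [|s _]; last first.
    apply/forallP => a; rewrite -(level_count_comp_perm f s a).
    by apply/eqP/eq_card => k; rewrite !inE ffunE.
  rewrite -sum_nat_const; apply: eq_bigr => h /forallP hh.
  rewrite -(K_const h) => [|a]; last by rewrite (eqP (hh a)).
  rewrite /K -sum1_card; apply: eq_bigl => s; rewrite !inE.
  apply/forallP/idP => [hs|/eqP <- k]; last by rewrite ffunE.
  by apply/eqP/ffunP => k; rewrite ffunE; apply/eqP.
rewrite -MF => /eqP; rewrite eqn_mul2l => /orP[|/eqP //].
by move=> /eqP M0; move: (fact_gt0 n); rewrite -MF M0.
Qed.

(** Given the name f, a permutation s determines the shifted name f \o s; there
    are as many shifted names as ways to refine the level sets of f, and each of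
    them comes from as many permutations as the stabiliser of f has elements. *)
Lemma card_perm_joint_count (n : nat) (A : finType) (f : 'I_n -> A) (N : A * A -> nat) :
  (forall a, \sum_b N (a, b) = level_count f a) ->
  (forall b, \sum_a N (a, b) = level_count f b) ->
  #|[pred s : {perm 'I_n} | [forall p, joint_count f (f \o s) p == N p]]|
    * \prod_p (N p)`! = (\prod_a (level_count f a)`!) ^ 2.
Proof.
move=> hl hr; rewrite -mulnn -{1}(card_joint_count hl) mulnAC; congr (_ * _).
rewrite -sum1_card (partition_big (fun s : {perm 'I_n} => [ffun k => f (s k)])
  [pred g : {ffun 'I_n -> A} | [forall p, joint_count f g p == N p]]) /=; last first.
  move=> s; rewrite inE => /forallP hs; apply/forallP => p; rewrite -(eqP (hs p)).
  by apply/eqP/eq_card => k; rewrite !inE ffunE.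
rewrite -sum_nat_const; apply: eq_bigr => g /forallP hg.
rewrite -(card_perm_comp_eq (f := f) (g := g)) => [|b]; last first.
  by rewrite -hr -(sum_joint_countr f g); apply: eq_bigr => a _; apply/esym/eqP.
rewrite -[RHS]sum1_card; apply: eq_bigl => s; rewrite !inE.
apply/andP/forallP => [[_ /eqP <-] k|hs]; first by rewrite ffunE.
split; last by apply/eqP/ffunP => k; rewrite ffunE; apply/eqP.
apply/forallP => p; rewrite -(eqP (hg p)); apply/eqP/eq_card => k.
by rewrite !inE /= (eqP (hs k)).
Qed.

Section count_models.
Variables (n r : nat) (A : finType).

(** The second component of a pair stands for the images of the [r] generators
    under a homomorphism. *)
Definition models (N : 'I_r -> A * A -> nat) :=
  [set q : {ffun 'I_n -> A} * {ffun 'I_r -> {perm 'I_n}} |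
    [forall j, forall p, joint_count q.1 (q.1 \o q.2 j) p == N j p]].

Lemma models_marginals N q : q \in models N ->
  (forall j a, \sum_b N j (a, b) = level_count q.1 a) /\
  (forall j b, \sum_a N j (a, b) = level_count q.1 b).
Proof.
rewrite inE => /forallP hq; split=> j a.
  by rewrite -(sum_joint_countl q.1 (q.1 \o q.2 j)); apply: eq_bigr => b _;
    rewrite (eqP (forallP (hq j) _)).
rewrite -(level_count_comp_perm q.1 (q.2 j)) -(sum_joint_countr q.1 (q.1 \o q.2 j)).
by apply: eq_bigr => b _; rewrite (eqP (forallP (hq j) _)).
Qed.

(** For each name with level counts [c] the permutations can be chosen
    independently of one another. The count is cross-multiplied, so that it stays
    in the natural numbers. *)
Lemma card_models (N : 'I_r -> A * A -> nat) (c : A -> nat) : 0 < r ->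
  \sum_a c a = n ->
  (forall j a, \sum_b N j (a, b) = c a) -> (forall j b, \sum_a N j (a, b) = c b) ->
  #|models N| * (\prod_j \prod_p (N j p)`!) * \prod_a (c a)`!
    = n`! * (\prod_a (c a)`!) ^ (2 * r).
Proof.
move=> r0 hc hl hr.
have -> : #|models N| * (\prod_j \prod_p (N j p)`!)
   = \sum_(f : {ffun 'I_n -> A} | [forall a, level_count f a == c a])
       (\prod_a (c a)`!) ^ (2 * r).
  rewrite -sum1_card (partition_big fst
    [pred f : {ffun 'I_n -> A} | [forall a, level_count f a == c a]]) /=; last first.
    move=> q hq; apply/forallP => a; have [/(_ (Ordinal r0) a) h _] := models_marginals hq.
    by rewrite -h hl.
  rewrite big_distrl /=; apply: eq_bigr => f /forallP hf.
  pose P j := [pred s : {perm 'I_n} | [forall p, joint_count f (f \o s) p == N j p]].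
  have -> : \sum_(i in models N | i.1 == f) 1 = #|family P|.
    rewrite -[RHS]sum1_card (reindex_onto (fun g => (f, g)) snd) /=; last first.
      by case=> f' g /= /andP[_ /eqP ->].
    apply: eq_bigl => g; rewrite [(f, g) \in _]inE /= !eqxx !andbT.
    apply/forallP/familyP => h j; first by rewrite inE; apply: h.
    by have := h j; rewrite inE.
  rewrite card_family foldrE big_map big_enum /=.
  rewrite -big_split /= (eq_bigr (fun=> (\prod_a (c a)`!) ^ 2)) => [|j _].
    by rewrite prod_nat_const card_ord -expnM.
  rewrite card_perm_joint_count => [|a|b].
  - by congr (_ ^ 2); apply: eq_bigr => a _; rewrite (eqP (hf a)).
  - by rewrite hl (eqP (hf a)).
  - by rewrite hr (eqP (hf b)).
rewrite sum_nat_const mulnAC; congr (_ * _).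
by rewrite -(card_level_count hc).
Qed.

End count_models.

Local Open Scope classical_set_scope.
Local Open Scope ring_scope.

(** * The function -x log x and Stirling bounds *)

Section entropy_function.
Context {R : realType}.
Implicit Types x y : R.

Definition xlogx_neg x : R := - (x * ln x).

(** This makes [x log x] small near 0 and [log n / n] small near infinity. *)
Lemma ln_le_sqrt x : 0 < x -> ln x <= 2 * Num.sqrt x.
Proof.
move=> x0; have s0 : 0 < Num.sqrt x by rewrite sqrtr_gt0.
rewrite -[in leLHS](sqr_sqrtr (ltW x0)) lnXn // mulr_natl ler_pMn2r //.
exact/ltW/ln_sublinear.
Qed.

Lemma xlogx_neg_ge0 x : 0 <= x <= 1 -> 0 <= xlogx_neg x.
Proof.
by move=> /andP[x0 x1]; rewrite oppr_ge0 mulr_ge0_le0 // ln_le0.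
Qed.

Lemma xlogx_neg_le_sqrt x : 0 <= x -> xlogx_neg x <= 2 * Num.sqrt x.
Proof.
rewrite le_eqVlt => /predU1P[<-|x0]; first by rewrite /xlogx_neg mul0r sqrtr0; lra.
have s0 : 0 < Num.sqrt x by rewrite sqrtr_gt0.
rewrite /xlogx_neg -mulrN -lnV ?posrE //.
apply: le_trans (ler_wpM2l (ltW x0) (ln_le_sqrt _)) _; first by rewrite invr_gt0.
rewrite sqrtrV ?(ltW x0) // -[in X in X * _](sqr_sqrtr (ltW x0)).
by rewrite mulrCA expr2 mulfK // gt_eqF.
Qed.

Lemma xlogx_neg_le1 x : 0 <= x -> xlogx_neg x <= 1.
Proof.
rewrite le_eqVlt => /predU1P[<-|x0]; first by rewrite /xlogx_neg mul0r oppr0.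
rewrite /xlogx_neg -mulrN -lnV ?posrE //.
rewrite -[leRHS](mulfV (lt0r_neq0 x0)) ler_wpM2l ?ltW //.
by apply: ln_sublinear; rewrite invr_gt0.
Qed.

Lemma xlogx_neg_continuous x : 0 <= x -> {for x, continuous xlogx_neg}.
Proof.
rewrite le_eqVlt => /predU1P[<-|x0]; last first.
  apply: cvgN; apply: cvgM; first exact: cvg_id.
  exact: continuous_ln.
apply/cvgrPdist_lt => e e0; near=> y.
rewrite [xlogx_neg 0]/xlogx_neg mul0r oppr0 sub0r normrN.
have [y0|y0] := leP y 0; first by rewrite /xlogx_neg ln0 // mulr0 oppr0 normr0.
have y1 : y < 1 by near: y; apply: lt_nbhsl.
rewrite ger0_norm ?xlogx_neg_ge0 ?(ltW y0) ?(ltW y1) //.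
apply: le_lt_trans (xlogx_neg_le_sqrt (ltW y0)) _.
rewrite -ltr_pdivlMl // -[ltRHS]ger0_norm; last by rewrite mulr_ge0 // ltW.
rewrite -sqrtr_sqr ltr_sqrt; last by rewrite exprn_gt0 // mulr_gt0.
by near: y; apply: lt_nbhsl; rewrite exprn_gt0 // mulr_gt0.
Unshelve. all: by end_near. Qed.

(** Entropies of counts and of frequencies differ by a term that is linear in the
    counts, and these terms cancel in ln_card_models. *)
Lemma xlogx_neg_scale (n k : nat) : (0 < n)%N ->
  xlogx_neg k%:R = n%:R * xlogx_neg (k%:R / n%:R) - k%:R * ln n%:R :> R.
Proof.
case: k => [|k] n0; first by rewrite /xlogx_neg !(mulr0n, mul0r, oppr0, mulr0, subr0).
have n1 : (n%:R : R) != 0 by rewrite pnatr_eq0 -lt0n.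
rewrite /xlogx_neg ln_div ?posrE ?ltr0n //.
by field.
Qed.

(** Both bounds are [ln (1 + x) <= x], at [x = 1 / k] and at
    [x = - 1 / (k + 1)]. *)
Lemma ln_succ_sub (k : nat) : (0 < k)%N ->
  k%:R * (ln k.+1%:R - ln k%:R) <= (1 : R) <= k.+1%:R * (ln k.+1%:R - ln k%:R).
Proof.
move=> k0; have k1 : 0 < (k%:R : R) by rewrite ltr0n.
have k2 : 0 < (k.+1%:R : R) by rewrite ltr0n.
apply/andP; split.
  rewrite -[leRHS](mulfV (lt0r_neq0 k1)) ler_wpM2l ?(ltW k1) // -ln_div ?posrE //.
  rewrite -natr1 mulrDl mulfV ?lt0r_neq0 // mul1r le_ln1Dx //.
  by rewrite (lt_trans _ (_ : 0 < k%:R^-1)) ?invr_gt0 // oppr_lt0.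
rewrite -[leLHS](mulfV (lt0r_neq0 k2)) ler_wpM2l ?(ltW k2) //.
rewrite -[_ - ln _]opprB lerNr -ln_div ?posrE //.
have -> : k%:R / k.+1%:R = 1 + (- k.+1%:R^-1) :> R.
  apply: (mulIf (lt0r_neq0 k2)); rewrite mulfVK ?lt0r_neq0 // mulrDl mulNr.
  by rewrite mulVf ?lt0r_neq0 // -natr1; ring.
by rewrite le_ln1Dx // ltrN2 invf_lt1 // ltr1n ltnS.
Qed.

(** Stirling's formula with a logarithmic error, by summing the bounds of
    ln_succ_sub. *)
Lemma ln_fact (k : nat) :
  0 <= ln k`!%:R + xlogx_neg k%:R + k%:R <= (1 + ln k.+1%:R : R).
Proof.
have step i : ln i.+1`!%:R = ln i.+1%:R + ln i`!%:R :> R.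
  by rewrite factS natrM lnM // posrE ltr0n // fact_gt0.
apply/andP; split.
  elim: k => [|k IH]; first by rewrite fact0 ln1 /xlogx_neg mul0r oppr0 !addr0.
  rewrite step; have [->|k0] := posnP k.
    by rewrite fact0 /xlogx_neg ln1 mulr0 oppr0 !addr0 add0r.
  have /andP[h _] := ln_succ_sub k0; move: IH h; rewrite /xlogx_neg.
  move: (ln k.+1%:R) (ln k%:R) (ln k`!%:R) => a b c; rewrite -natr1; lra.
have up : ln k`!%:R + k%:R <= (k.+1%:R * ln k.+1%:R : R).
  elim: k => [|k IH]; first by rewrite fact0 ln1 mulr0 addr0.
  rewrite step; have /andP[_ h] := ln_succ_sub (ltn0Sn k).
  move: IH h; move: (ln k.+2%:R) (ln k.+1%:R) (ln k`!%:R) => a b c.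
  rewrite -!natr1; lra.
have [->|k0] := posnP k.
  by rewrite fact0 /xlogx_neg mulr0n mul0r ln1; lra.
move: up; have /andP[h _] := ln_succ_sub k0; move: h; rewrite /xlogx_neg.
move: (ln k.+1%:R) (ln k%:R) (ln k`!%:R) => a b c; rewrite -natr1; lra.
Qed.

End entropy_function.

(** * Families of couplings with common margins *)

Lemma xlogx_neg_equicontinuous (R : realType) (I : finType) (x : I -> R) (d : R) :
  (forall i, 0 <= x i) -> 0 < d ->
  exists2 e : R, 0 < e &
    forall i y, `|y - x i| < e -> `|xlogx_neg y - xlogx_neg (x i)| <= d.
Proof.
move=> x0 d0; have H : \forall e \near (0 : R)^'+,
    forall i y, `|y - x i| < e -> `|xlogx_neg y - xlogx_neg (x i)| <= d.
  apply: filter_forall => i.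
  have /cvgrPdist_le /(_ d d0) [e /= e0 he] := xlogx_neg_continuous (x0 i).
  near=> e' => y ye; rewrite distrC; apply: he => /=; rewrite distrC.
  by apply: lt_trans ye _; near: e'; apply: nbhs_right_lt.
by have [e [? ?]] := filter_ex (filterI H (nbhs_right_gt 0)); exists e.
Unshelve. all: by end_near. Qed.

Lemma sum_convex_comb (R : realType) (I : finType) (f g : I -> R) (t : R) :
  \sum_i ((1 - t) * f i + t * g i) = (1 - t) * \sum_i f i + t * \sum_i g i.
Proof. by rewrite big_split /= -!mulr_sumr. Qed.

Lemma big_pairE (V : nmodType) (I J : finType) (f : I * J -> V) :
  \sum_p f p = \sum_i \sum_j f (i, j).
Proof. by rewrite pair_bigA; apply: eq_bigr => -[]. Qed.

Section coupling_families.
Context {R : realType} {r : nat} {A : finType}.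
Implicit Types (c : A -> R) (q : 'I_r -> A * A -> R).

(** Each [q j] is a coupling of the distribution [c] with itself. Joint types
    divided by [n] have this property, and so do the laws of
    [(phi, phi o T_{s_j})] since [T] preserves the measure. *)
Definition coupling_family c q :=
  [/\ forall j p, 0 <= q j p, \sum_a c a = 1,
      forall j a, \sum_b q j (a, b) = c a & forall j b, \sum_a q j (a, b) = c b].

(** The functional [F] of an observable whose one-point law is [c] and whose
    two-point laws along the generators are the [q j]. *)
Definition F_value c q : R :=
  (1 - 2 * r%:R) * \sum_a xlogx_neg (c a) + \sum_j \sum_p xlogx_neg (q j p).

Definition l1_dist q q' : R := \sum_j \sum_p `|q j p - q' j p|.

Lemma coupling_family_le1 c q : (0 < r)%N -> coupling_family c q ->
  (forall a, 0 <= c a <= 1) /\ (forall j p, 0 <= q j p <= 1).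
Proof.
move=> r0 [q0 c1 ql qr].
have c0 a : 0 <= c a by rewrite -(ql (Ordinal r0)) sumr_ge0.
have c01 a : 0 <= c a <= 1.
  by rewrite c0 -c1 (bigD1 a) //= lerDl sumr_ge0.
split=> // j [a b]; rewrite q0 /=; have /andP[_] := c01 a; apply: le_trans.
by rewrite -(ql j) (bigD1 b) //= lerDl sumr_ge0.
Qed.

(** The sum over [c] has the coefficient [1 - 2 r <= 0]. *)
Lemma F_value_le c q : (0 < r)%N -> coupling_family c q ->
  F_value c q <= r%:R * #|{: A * A}|%:R.
Proof.
move=> r0 cq; have [c01 q01] := coupling_family_le1 r0 cq.
rewrite /F_value -[leRHS]add0r; apply: lerD.
  apply: mulr_le0_ge0; last by apply: sumr_ge0 => a _; rewrite xlogx_neg_ge0.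
  have : 1 <= r%:R :> R by rewrite ler1n.
  by lra.
apply: (@le_trans _ _ (\sum_(j < r) \sum_(p : A * A) 1)).
  apply: ler_sum => j _; apply: ler_sum => p _.
  by apply: xlogx_neg_le1; case/andP: (q01 j p).
by rewrite !sumr_const card_ord mulr_natl.
Qed.

Lemma F_value_continuous c q (d : R) : (0 < r)%N -> coupling_family c q -> 0 < d ->
  exists2 e : R, 0 < e & forall c' q',
    (forall a, `|c' a - c a| < e) -> (forall j p, `|q' j p - q j p| < e) ->
    `|F_value c' q' - F_value c q| <= d.
Proof.
move=> r0 cq d0; have [c01 q01] := coupling_family_le1 r0 cq.
(* The sum of the absolute values of the coefficients; 1 makes it positive. *)
pose C : R := `|1 - 2 * r%:R| * #|A|%:R + r%:R * #|{: A * A}|%:R + 1.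
have C0 : 0 < C by rewrite ltr_wpDl // addr_ge0 ?mulr_ge0.
have dC0 : 0 < d / C by rewrite divr_gt0.
have [|e1 e10 he1] := @xlogx_neg_equicontinuous R _ c (d / C) _ dC0.
  by move=> a; case/andP: (c01 a).
have [|e2 e20 he2] := @xlogx_neg_equicontinuous R _
    (fun i : 'I_r * (A * A) => q i.1 i.2) (d / C) _ dC0.
  by move=> [j p]; case/andP: (q01 j p).
exists (Num.min e1 e2) => [|c' q' hc hq]; first by rewrite lt_min e10.
have -> : F_value c' q' - F_value c q =
    (1 - 2 * r%:R) * \sum_a (xlogx_neg (c' a) - xlogx_neg (c a))
    + \sum_j \sum_p (xlogx_neg (q' j p) - xlogx_neg (q j p)).
  have -> : \sum_j \sum_p (xlogx_neg (q' j p) - xlogx_neg (q j p)) =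
      \sum_j \sum_p xlogx_neg (q' j p) - \sum_j \sum_p xlogx_neg (q j p).
    by rewrite -sumrB; apply: eq_bigr => j _; rewrite sumrB.
  by rewrite /F_value sumrB; ring.
have -> : d = `|1 - 2 * r%:R| * (#|A|%:R * (d / C))
    + r%:R * (#|{: A * A}|%:R * (d / C)) + d / C.
  by rewrite /C; field; rewrite -/C lt0r_neq0.
apply: le_trans (ler_normD _ _) _.
rewrite -[leLHS]addr0; apply: lerD (ltW dC0); apply: lerD.
  rewrite normrM ler_wpM2l //; apply: le_trans (ler_norm_sum _ _ _) _.
  rewrite mulr_natl -sumr_const; apply: ler_sum => a _; apply: he1.
  by have := hc a; rewrite lt_min => /andP[].
apply: le_trans (ler_norm_sum _ _ _) _.
rewrite mulr_natl -[X in _ *+ X]card_ord -sumr_const; apply: ler_sum => j _.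
apply: le_trans (ler_norm_sum _ _ _) _.
rewrite mulr_natl -sumr_const; apply: ler_sum => p _; apply: (he2 (j, p)).
by have := hq j p; rewrite lt_min => /andP[].
Qed.

Lemma coupling_family_mix c q c' q' (t : R) : 0 <= t <= 1 ->
  coupling_family c q -> coupling_family c' q' ->
  coupling_family (fun a => (1 - t) * c a + t * c' a)
                  (fun j p => (1 - t) * q j p + t * q' j p).
Proof.
move=> /andP[t0 t1] [q0 c1 ql qr] [q0' c1' ql' qr']; split=> [j p||j a|j b].
- by rewrite addr_ge0 ?mulr_ge0 // subr_ge0.
- by rewrite sum_convex_comb c1 c1'; ring.
- by rewrite sum_convex_comb ql ql'.
- by rewrite (sum_convex_comb (fun a => q j (a, b)) (fun a => q' j (a, b))) qr qr'.
Qed.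

(** Moving [q'] towards [q] brings it strictly closer, which gives room for the
    integer approximation. *)
Lemma l1_dist_mixl q q' (t : R) : 0 <= t <= 1 ->
  l1_dist q (fun j p => (1 - t) * q' j p + t * q j p) = (1 - t) * l1_dist q q'.
Proof.
move=> /andP[t0 t1]; rewrite /l1_dist mulr_sumr; apply: eq_bigr => j _.
rewrite mulr_sumr; apply: eq_bigr => p _.
rewrite -[X in _ = X * _]ger0_norm ?subr_ge0 // -normrM; congr (`|_|); ring.
Qed.

Lemma coord_le_l1_dist q q' j p : `|q j p - q' j p| <= l1_dist q q'.
Proof.
rewrite /l1_dist (bigD1 j) //= (bigD1 p) //= -addrA lerDl addr_ge0 ?sumr_ge0 //.
by move=> i _; apply: sumr_ge0.
Qed.

Lemma l1_dist_triangle q1 q2 q3 : l1_dist q1 q3 <= l1_dist q1 q2 + l1_dist q2 q3.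
Proof.
rewrite /l1_dist -big_split /=; apply: ler_sum => j _.
by rewrite -big_split /=; apply: ler_sum => p _; apply: ler_distD.
Qed.

Lemma l1_dist_le q q' (e : R) : (forall j p, `|q j p - q' j p| <= e) ->
  l1_dist q q' <= (r * #|{: A * A}|)%:R * e.
Proof.
move=> h; rewrite natrM -mulrA mulr_natl -[X in _ *+ X]card_ord -sumr_const.
by apply: ler_sum => j _; rewrite mulr_natl -sumr_const; apply: ler_sum.
Qed.

Lemma marginal_dist_le c q c' q' (j : 'I_r) : coupling_family c q ->
  coupling_family c' q' -> forall a, `|c a - c' a| <= l1_dist q q'.
Proof.
move=> [_ _ ql _] [_ _ ql' _] a; rewrite -(ql j) -(ql' j) -sumrB.
apply: le_trans (ler_norm_sum _ _ _) _.
rewrite /l1_dist (bigD1 j) //= big_pairE.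
rewrite [X in _ <= X + _](bigD1 a) //= -addrA lerDl.
by rewrite addr_ge0 ?sumr_ge0 // => i _; apply: sumr_ge0.
Qed.

End coupling_families.

(** * Approximation by integer matrices *)

Lemma sum_indicator (I : finType) (i0 : I) (f : I -> nat) :
  (\sum_i (i == i0) * f i = f i0)%N.
Proof.
rewrite (bigD1 i0) //= eqxx mul1n big1 ?addn0 // => i /negbTE ->.
by rewrite mul0n.
Qed.

(** Rounding down the entries of [m q] and the margins [m c] with [m = n - K],
    [K = #|A * A|], leaves non-negative defects in all rows and columns. The row
    defects are put in column [a0] and the column defects in row [a0]; whatever
    is then missing from the total [n] goes to the entry [(a0, a0)]. The slack
    [K] keeps this last correction non-negative, because rounding [K] entries
    loses at most [K]. *)
Lemma coupling_family_integer_approx (R : realType) (r : nat) (A : finType)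
    (c : A -> R) (q : 'I_r -> A * A -> R) (n : nat) : (0 < r)%N ->
  coupling_family c q -> (#|{: A * A}| <= n)%N ->
  exists (c' : A -> nat) (N : 'I_r -> A * A -> nat),
  [/\ [/\ (\sum_a c' a = n)%N,
        forall j a, (\sum_b N j (a, b) = c' a)%N &
        forall j b, (\sum_a N j (a, b) = c' b)%N],
      forall a, `|n%:R * c a - (c' a)%:R| <= 4 * #|{: A * A}|%:R &
      forall j p, `|n%:R * q j p - (N j p)%:R| <= 4 * #|{: A * A}|%:R].
Proof.
move=> r0 cq Kn; have [q0 c1 ql qr] := cq.
have [c01 q01] := coupling_family_le1 r0 cq.
set K := #|{: A * A}| in Kn *.
have [a0 _ | A0] := pickP (@predT A); last first.
  by move/eqP: c1; rewrite big_pred0 // eq_sym oner_eq0.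
have K1 : (1 <= K)%N by apply/card_gt0P; exists (a0, a0).
pose m := (n - K)%N; have nm : n = (m + K)%N by rewrite subnK.
pose fl (x : R) := Num.truncn (m%:R * x).
have fl_le x : 0 <= x -> (fl x)%:R <= m%:R * x.
  by move=> x0; rewrite truncn_le mulr_ge0.
have le_fl x : m%:R * x <= (fl x)%:R + 1 by rewrite natr1 ltW // truncnS_gt.
have fl_sum (I : finType) (x : I -> R) y : (forall i, 0 <= x i) ->
    \sum_i x i = y -> (\sum_i fl (x i) <= fl y)%N.
  move=> x0 <-; rewrite truncn_ge_nat; last by rewrite mulr_ge0 // sumr_ge0.
  by rewrite natr_sum mulr_sumr; apply: ler_sum => i _; apply: fl_le.
pose f j p := fl (q j p); pose d a := fl (c a); pose S := (\sum_a d a)%N.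
have rowle j a : (\sum_b f j (a, b) <= d a)%N by apply: fl_sum => // b.
have colle j b : (\sum_a f j (a, b) <= d b)%N.
  by apply: (fl_sum _ (fun a => q j (a, b))).
(* Row and column defects of the rounded matrix; tau is their common total. *)
pose rho j a := (d a - \sum_b f j (a, b))%N.
pose gam j b := (d b - \sum_a f j (a, b))%N.
pose tau j := (\sum_a rho j a)%N.
have rhoE j : (\sum_p f j p + tau j = S)%N.
  rewrite big_pairE -big_split /=; apply: eq_bigr => a _.
  by rewrite addnC subnK.
have gamE j : (\sum_b gam j b = tau j)%N.
  apply: (@addnI (\sum_p f j p)%N); rewrite rhoE big_pairE exchange_big -big_split /=.
  by apply: eq_bigr => b _; rewrite addnC subnK.
have Sm : (S <= m)%N.
  have : (S <= fl 1%R)%N by apply: fl_sum => // a; case/andP: (c01 a).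
  by rewrite /fl mulr1 natrK.
(* Each of the K entries loses less than 1 by rounding. *)
have mf j : (m <= \sum_p f j p + K)%N.
  have -> : K = (\sum_(p : A * A) 1)%N by rewrite sum1_card.
  have qs : \sum_p q j p = 1.
    by rewrite -c1 big_pairE; apply: eq_bigr => a _; rewrite ql.
  rewrite -big_split -(ler_nat R) natr_sum /= -[m%:R]mulr1 -[X in _ * X <= _]qs.
  by rewrite mulr_sumr; apply: ler_sum => p _; rewrite natrD; apply: le_fl.
pose c' a := (d a + (a == a0) * (n - S))%N.
pose N j (p : A * A) := (f j p + (p.2 == a0) * rho j p.1 + (p.1 == a0) * gam j p.2
   + (p.1 == a0) * ((p.2 == a0) * (n - S - tau j)))%N.
have close (x : R) k : 0 <= x <= 1 -> (fl x <= k <= fl x + 4 * K)%N ->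
    `|n%:R * x - k%:R| <= 4 * K%:R.
  move=> /andP[x0 x1]; rewrite -!(ler_nat R) natrD natrM nm natrD => /andP[h1 h2].
  have K1' : 1 <= K%:R :> R by rewrite ler1n.
  have := fl_le _ x0; have := le_fl x; rewrite ler_norml.
  have : K%:R * x <= K%:R by rewrite ler_piMr.
  have : 0 <= K%:R * x by rewrite mulr_ge0.
  lra.
have j0 : 'I_r := Ordinal r0.
have nS : (n - S <= 2 * K)%N by have := mf j0; have := rhoE j0; lia.
exists c', N; split; [split| |].
- by rewrite big_split /= sum_indicator; have := Sm; rewrite -/S; lia.
- move=> j a; rewrite !big_split /= sum_indicator -!big_distrr /= gamE.
  rewrite sum_indicator /c' /rho; have := rowle j a; have := mf j; have := rhoE j.
  by case: (a == a0); rewrite ?mul0n ?mul1n; lia.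
- move=> j b; rewrite !big_split /= sum_indicator -!big_distrr /=.
  rewrite sum_indicator /c' /gam; have := colle j b; have := mf j; have := rhoE j.
  by rewrite -/(tau j); case: (b == a0); rewrite ?mul0n ?mul1n; lia.
- move=> a; apply: close => //; rewrite /c' -/(d a).
  by case: (a == a0); lia.
- move=> j [a b]; apply: close => //; rewrite /N -/(f j (a, b)) /=.
  have h1 : (rho j a <= tau j)%N by rewrite /tau (bigD1 a) //= leq_addr.
  have h2 : (gam j b <= tau j)%N by rewrite -gamE (bigD1 b) //= leq_addr.
  have := mf j; have := rhoE j.
  by case: (a == a0); case: (b == a0); lia.
Qed.

(** * Exponential size of a joint type class *)

Lemma ln_prod_nat (R : realType) (I : finType) (f : I -> nat) :
  (forall i, 0 < f i)%N -> ln (\prod_i f i)%:R = \sum_i ln (f i)%:R :> R.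
Proof.
move=> f0; suff [] : (0 < \prod_i f i)%N /\
    ln (\prod_i f i)%:R = \sum_i ln (f i)%:R :> R by [].
elim/big_rec2: _ => [|i y x _ [x0 <-]]; first by rewrite ln1.
by rewrite muln_gt0 f0 x0 natrM lnM // posrE ltr0n.
Qed.

(** The logarithmic errors are negligible after division by [n]. *)
Lemma log_little_o (R : realType) (C d : R) : 0 < d ->
  \forall n \near \oo, C * (1 + ln n.+1%:R) <= d * n%:R.
Proof.
move=> d0; near=> n.
have C0 : C <= `|C| by apply: ler_norm.
have s0 : 0 <= 1 + ln n.+1%:R :> R by rewrite addr_ge0 ?ln_ge0 // ler1n.
apply: le_trans (ler_wpM2r s0 C0) _.
set s : R := Num.sqrt n.+1%:R.
have ss : s ^+ 2 = n%:R + 1 by rewrite sqr_sqrtr // natr1.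
have ln_s : ln n.+1%:R <= 2 * s by apply: ln_le_sqrt; rewrite ltr0n.
have : 2 + 6 * `|C| / d <= s.
  have D0 : 0 <= 2 + 6 * `|C| / d by rewrite addr_ge0 // divr_ge0 ?mulr_ge0 // ltW.
  rewrite -(ger0_norm D0) -sqrtr_sqr ler_sqrt ?ltr0n //.
  apply: (@le_trans _ _ n%:R); last by rewrite ler_nat.
  near: n; exact: nbhs_infty_ger.
have C1 : 6 * `|C| = d * (6 * `|C| / d) by field; rewrite lt0r_neq0.
have := normr_ge0 C; move: (6 * `|C| / d) C1 => t C1 C2 ts.
have t0 : 0 <= t by rewrite -(pmulr_rge0 _ d0) -C1 mulr_ge0.
have -> : n%:R = s ^+ 2 - 1 by rewrite ss addrK.
apply: (@le_trans _ _ (`|C| * (1 + 2 * s))); first by rewrite ler_wpM2l // lerD2l.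
have -> : `|C| = d * t / 6 by rewrite -C1; field.
rewrite -!mulrA ler_pM2l //; nra.
Unshelve. all: by end_near. Qed.

Section counting_estimate.
Context {R : realType} {r : nat} {A : finType}.

(** This bounds the sum of the absolute exponents of the factorials in the size
    of a joint type class; Stirling's formula costs at most [1 + ln (n + 1)] for
    each of them. *)
Definition log_error : R :=
  r%:R + 1 + (2 * r%:R + 1) * #|A|%:R + r%:R * #|{: A * A}|%:R.

(** Take logarithms in card_models and insert Stirling's formula for each
    factorial. The linear terms cancel: the arguments of the factorials, counted
    with the exponents [1 - r], [2 r - 1] and [- 1], add up to
    [(1 - r) n + (2 r - 1) n - r n = 0]. *)
Lemma ln_card_models (n : nat) (N : 'I_r -> A * A -> nat) (c : A -> nat) :
  (0 < r)%N -> (0 < n)%N -> (\sum_a c a = n)%N ->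
  (forall j a, \sum_b N j (a, b) = c a)%N ->
  (forall j b, \sum_a N j (a, b) = c b)%N ->
  (0 < #|models n N|)%N /\
  `|ln (#|models n N|%:R / n`!%:R ^+ r)
    - n%:R * F_value (fun a => (c a)%:R / n%:R) (fun j p => (N j p)%:R / n%:R)|
  <= log_error * (1 + ln n.+1%:R).
Proof.
move=> r0 n0 hc hl hr; have := card_models r0 hc hl hr.
set Z := #|models n N|; set PN := (\prod_j _)%N; set PC := (\prod_a _)%N => cardE.
have PC0 : (0 < PC)%N by apply: prodn_gt0 => a; apply: fact_gt0.
have PN0 : (0 < PN)%N by apply: prodn_gt0 => j; apply: prodn_gt0 => p; apply: fact_gt0.
(* The right-hand side of the counting identity is positive. *)
have Z0 : (0 < Z)%N.
  have : (0 < Z * PN * PC)%N by rewrite cardE muln_gt0 fact_gt0 expn_gt0 PC0.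
  by rewrite !muln_gt0 => /andP[/andP[]].
split=> //.
(* The error in Stirling's formula. *)
pose e k : R := ln k`!%:R + xlogx_neg k%:R + k%:R.
set L := 1 + _; have eL k : (k <= n)%N -> `|e k| <= L.
  move=> kn; have /andP[e0 e1] := @ln_fact R k.
  rewrite ger0_norm //; apply: le_trans e1 _.
  by rewrite lerD2l ler_ln ?posrE ?ltr0n // ler_nat.
pose g k : R := n%:R * xlogx_neg (k%:R / n%:R).
have factE k : ln k`!%:R = (ln n%:R - 1) * k%:R - g k + e k.
  by rewrite /e /g (xlogx_neg_scale _ n0); ring.
have gn : g n = 0 by rewrite /g /xlogx_neg divff ?pnatr_eq0 -?lt0n // ln1 mulr0 oppr0 mulr0.
have cn a : (c a <= n)%N by rewrite -hc (bigD1 a) //= leq_addr.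
have Nn j p : (N j p <= n)%N.
  by case: p => a b; apply: leq_trans (cn a); rewrite -(hl j) (bigD1 b) //= leq_addr.
have lnPC : ln PC%:R = (ln n%:R - 1) * n%:R - \sum_a g (c a) + \sum_a e (c a).
  rewrite ln_prod_nat => [|a]; last exact: fact_gt0.
  under eq_bigr => a _ do rewrite factE.
  by rewrite big_split /= sumrB -mulr_sumr -natr_sum hc.
have lnPN : ln PN%:R = r%:R * ((ln n%:R - 1) * n%:R)
    - \sum_j \sum_p g (N j p) + \sum_j \sum_p e (N j p).
  rewrite ln_prod_nat => [|j]; last by apply: prodn_gt0 => p; apply: fact_gt0.
  rewrite (eq_bigr (fun j => (ln n%:R - 1) * n%:R
      - \sum_p g (N j p) + \sum_p e (N j p))) => [|j _]; last first.
    rewrite ln_prod_nat => [|p]; last exact: fact_gt0.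
    under eq_bigr => p _ do rewrite factE.
    rewrite big_split /= sumrB -mulr_sumr -natr_sum; congr (_ * _%:R - _ + _).
    by rewrite big_pairE -hc; apply: eq_bigr => a _.
  by rewrite big_split /= sumrB sumr_const card_ord mulr_natl.
have lnZ : ln (Z%:R / n`!%:R ^+ r) =
    (1 - r%:R) * ln n`!%:R + (2 * r%:R - 1) * ln PC%:R - ln PN%:R :> R.
  have /(congr1 (fun k : nat => ln k%:R : R)) := cardE.
  rewrite !natrM natrX.
  rewrite ln_div ?posrE ?exprn_gt0 ?ltr0n ?fact_gt0 //.
  rewrite !lnM ?posrE ?mulr_gt0 ?exprn_gt0 ?ltr0n ?fact_gt0 //.
  rewrite !lnXn ?ltr0n ?fact_gt0 // -[ln n`!%:R *+ r]mulr_natl -[_ *+ (2 * r)]mulr_natl natrM.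
  by lra.
have -> : n%:R * F_value (fun a => (c a)%:R / n%:R) (fun j p => (N j p)%:R / n%:R)
   = (1 - 2 * r%:R) * \sum_a g (c a) + \sum_j \sum_p g (N j p).
  rewrite /F_value mulrDr mulrCA; congr (_ * _ + _); rewrite mulr_sumr //.
  by apply: eq_bigr => j _; rewrite mulr_sumr.
have -> : ln (Z%:R / n`!%:R ^+ r)
    - ((1 - 2 * r%:R) * \sum_a g (c a) + \sum_j \sum_p g (N j p))
   = (1 - r%:R) * e n + (2 * r%:R - 1) * \sum_a e (c a) - \sum_j \sum_p e (N j p).
  by rewrite lnZ lnPC lnPN factE gn; ring.
have L0 : 0 <= L by apply: le_trans (eL n (leqnn n)).
have r1 : 1 <= r%:R :> R by rewrite ler1n.
have -> : log_error * L = (r%:R + 1) * L + (2 * r%:R + 1) * (#|A|%:R * L)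
    + r%:R * (#|{: A * A}|%:R * L) by rewrite /log_error; ring.
apply: le_trans (ler_normB _ _) _; apply: lerD.
  apply: le_trans (ler_normD _ _) _; rewrite !normrM; apply: lerD.
    by apply: ler_pM => //; [rewrite ler_norml; lra | apply: eL].
  apply: ler_pM => //; first by rewrite ler_norml; lra.
  apply: le_trans (ler_norm_sum _ _ _) _; rewrite mulr_natl -sumr_const.
  by apply: ler_sum => a _; apply: eL.
apply: le_trans (ler_norm_sum _ _ _) _; rewrite mulr_natl -[X in _ *+ X]card_ord -sumr_const.
apply: ler_sum => j _; apply: le_trans (ler_norm_sum _ _ _) _.
by rewrite mulr_natl -sumr_const; apply: ler_sum => p _; apply: eL.
Qed.

End counting_estimate.

(** * Growth rate of the mean number of models *)

Section limit.
Context {R : realType} {r : nat} {A : finType}.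
Variables (m : A -> R) (p : 'I_r -> A * A -> R).
Hypothesis r0 : (0 < r)%N.
Hypothesis mp : coupling_family m p.
Implicit Types (eps d : R) (n : nat).

Definition good_models eps n :=
  [set Q : {ffun 'I_n -> A} * {ffun 'I_r -> {perm 'I_n}} |
    l1_dist p (fun j x => (joint_count Q.1 (Q.1 \o Q.2 j) x)%:R / n%:R) <= eps]%SET.

(** The expected number of models, for independent uniform permutations as the
    images of the generators. *)
Definition mean_models eps n : R := #|good_models eps n|%:R / n`!%:R ^+ r.

Definition near_couplings eps : set ((A -> R) * ('I_r -> A * A -> R)) :=
  [set x | coupling_family x.1 x.2 /\ l1_dist p x.2 <= eps].

(** This is the growth rate of [mean_models eps], by mean_models_cvg. *)
Definition max_F eps : R := sup [set F_value x.1 x.2 | x in near_couplings eps].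

Lemma near_couplings_refl eps : 0 <= eps -> near_couplings eps (m, p).
Proof.
move=> e0; split=> //=; rewrite /l1_dist big1 // => j _.
by rewrite big1 // => x _; rewrite subrr normr0.
Qed.

Lemma has_sup_F eps : 0 <= eps ->
  has_sup [set F_value x.1 x.2 | x in near_couplings eps].
Proof.
move=> e0; split; first by exists (F_value m p), (m, p) => //; apply: near_couplings_refl.
by exists (r%:R * #|{: A * A}|%:R) => _ [x [cx _] <-]; apply: F_value_le.
Qed.

Lemma F_value_le_max eps x : 0 <= eps -> near_couplings eps x ->
  F_value x.1 x.2 <= max_F eps.
Proof. by move=> e0 hx; apply: sup_upper_bound; [apply: has_sup_F | exists x]. Qed.

Lemma factX_gt0 n : 0 < n`!%:R ^+ r :> R.
Proof. by rewrite exprn_gt0 // ltr0n fact_gt0. Qed.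

Lemma joint_types_near_coupling eps n (Q : {ffun 'I_n -> A} * {ffun 'I_r -> {perm 'I_n}}) :
  (0 < n)%N -> Q \in good_models eps n ->
  near_couplings eps (fun a => (level_count Q.1 a)%:R / n%:R,
    fun j x => (joint_count Q.1 (Q.1 \o Q.2 j) x)%:R / n%:R).
Proof.
move=> n0; rewrite inE => hQ; split=> //=; split=> [j x||j a|j b].
- by rewrite divr_ge0.
- by rewrite -mulr_suml -natr_sum sum_level_count divff // pnatr_eq0 -lt0n.
- by rewrite -mulr_suml -natr_sum sum_joint_countl.
- by rewrite -mulr_suml -natr_sum sum_joint_countr level_count_comp_perm.
Qed.

Lemma joint_count_lt n (f g : 'I_n -> A) x : (joint_count f g x < n.+1)%N.
Proof. by rewrite ltnS -[n in (_ <= n)%N]card_ord max_card. Qed.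

(** The good pairs are split by joint type. Each class has at most
    [n!^r exp (n max_F + O(log n))] elements, and the number [(n + 1)^(r |A|^2)]
    of classes only contributes to the logarithmic error. *)
Lemma mean_models_upper eps n : 0 <= eps -> (0 < n)%N -> 0 < mean_models eps n ->
  ln (mean_models eps n) <= n%:R * max_F eps
    + (@log_error R r A + r%:R * #|{: A * A}|%:R) * (1 + ln n.+1%:R).
Proof.
move=> e0 n0 mean0; set L : R := 1 + _.
have L1 : ln n.+1%:R <= L by rewrite /L lerDr.
pose B : R := n%:R * max_F eps + @log_error R r A * L.
pose T := {ffun 'I_r -> {ffun A * A -> 'I_n.+1}}.
pose jt (Q : {ffun 'I_n -> A} * {ffun 'I_r -> {perm 'I_n}}) : T :=
  [ffun j => [ffun x => Ordinal (joint_count_lt Q.1 (Q.1 \o Q.2 j) x)]].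
have term (t : T) : (#|[pred Q in good_models eps n | jt Q == t]|)%:R
    <= n`!%:R ^+ r * expR B.
  have [|] := ltnP 0 #|[pred Q in good_models eps n | jt Q == t]|; last first.
    by rewrite leqn0 => /eqP ->; rewrite mulr_ge0 ?expR_ge0 // ltW ?factX_gt0.
  case/card_gt0P => Q /andP[gQ /eqP <-].
  pose N j x := joint_count Q.1 (Q.1 \o Q.2 j) x.
  have hl j a : (\sum_b N j (a, b) = level_count Q.1 a)%N by apply: sum_joint_countl.
  have hr j b : (\sum_a N j (a, b) = level_count Q.1 b)%N.
    by rewrite sum_joint_countr level_count_comp_perm.
  have [Z0 lnZ] := @ln_card_models R r A n N _ r0 n0 (sum_level_count _) hl hr.
  apply: (@le_trans _ _ #|models n N|%:R).
    rewrite ler_nat; apply/subset_leq_card/fintype.subsetP => Q' /andP[_ /eqP E].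
    rewrite inE; apply/forallP => j; apply/forallP => x.
    by have := congr1 (fun t : T => val (t j x)) E; rewrite /jt !ffunE /= => ->.
  rewrite mulrC -ler_pdivrMr ?factX_gt0 // -ler_ln ?posrE ?expR_gt0 //; last first.
    by rewrite divr_gt0 ?factX_gt0 // ltr0n.
  rewrite expRK /B; move: lnZ; rewrite ler_norml => /andP[_ h].
  have := F_value_le_max e0 (joint_types_near_coupling n0 gQ) => /= hF.
  have := ler_wpM2l (ler0n R n) hF; rewrite -/N -/L in h *; lra.
have cardT : #|T|%:R = expR (r%:R * #|{: A * A}|%:R * ln n.+1%:R) :> R.
  rewrite !card_ffun !card_ord -expnM natrX -[in LHS](@lnK R n.+1%:R) ?posrE ?ltr0n //.
  by rewrite -expRM_natl natrM; congr (expR (_ * _)); rewrite mulrC.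
have : mean_models eps n <= #|T|%:R * expR B.
  rewrite /mean_models ler_pdivrMr ?factX_gt0 // -sum1_card.
  rewrite (partition_big jt predT) //= natr_sum -mulrA mulr_natl -sumr_const.
  apply: ler_sum => t _; rewrite sum1_card mulrC; apply: le_trans (term t).
  by rewrite ler_nat; apply/eq_leq/eq_card => Q; rewrite !inE.
rewrite cardT -expRD -ler_ln ?posrE ?expR_gt0 // expRK => h; apply: le_trans h _.
have h0 : 0 <= r%:R * #|{: A * A}|%:R :> R by rewrite mulr_ge0.
have := ler_wpM2l h0 L1; rewrite /B; lra.
Qed.

(** A single joint type close to [n q] already provides enough models. The
    inequality [l1_dist p q < eps] is strict, so this joint type is still within
    [eps] of [p]. *)
Lemma mean_models_lower eps d (c : A -> R) q : coupling_family c q ->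
  l1_dist p q < eps -> 0 < d ->
  \forall n \near \oo, 0 < mean_models eps n /\
    n%:R * (F_value c q - d) <= ln (mean_models eps n).
Proof.
move=> cq dq d0; have d20 : 0 < d / 2 by rewrite divr_gt0.
have [e e0 he] := F_value_continuous r0 cq d20.
set K := #|{: A * A}|.
have e'0 : 0 < Num.min e ((eps - l1_dist p q) / ((r * K)%:R + 1)).
  by rewrite lt_min e0 divr_gt0 ?subr_gt0 // ltr_wpDl.
(* Entries within e' of q keep F within d / 2 and the distance below eps. *)
set e' := Num.min _ _ in e'0.
near=> n.
have n0 : (0 < n)%N by near: n; exact: nbhs_infty_gt.
have nR : 0 < n%:R :> R by rewrite ltr0n.
have nK : (K <= n)%N by near: n; exact: nbhs_infty_ge.
have [c' [N [[hc hl hr] c'c Nq]]] := coupling_family_integer_approx r0 cq nK.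
have nKe : 4 * K%:R < n%:R * e'.
  rewrite -ltr_pdivrMr //; near: n; exact: nbhs_infty_gtr.
have scale (x : R) k : `|n%:R * x - k%:R| <= 4 * K%:R -> `|k%:R / n%:R - x| < e'.
  move=> h; rewrite -(ltr_pM2l nR) -[X in X * _ < _](gtr0_norm nR) -normrM.
  rewrite mulrBr mulrCA divff ?lt0r_neq0 // mulr1 distrC.
  exact: le_lt_trans h nKe.
have [Z0 lnZ] := @ln_card_models R r A n N c' r0 n0 hc hl hr.
have hF : `|F_value (fun a => (c' a)%:R / n%:R) (fun j x => (N j x)%:R / n%:R)
    - F_value c q| <= d / 2.
  apply: he => [a|j x].
    by apply: lt_le_trans (scale _ _ (c'c a)) _; rewrite ge_min lexx.
  by apply: lt_le_trans (scale _ _ (Nq j x)) _; rewrite ge_min lexx.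
have sub : (#|models n N| <= #|good_models eps n|)%N.
  apply/subset_leq_card/fintype.subsetP => Q; rewrite !inE => /forallP hQ.
  have -> : l1_dist p (fun j x => (joint_count Q.1 (Q.1 \o Q.2 j) x)%:R / n%:R)
      = l1_dist p (fun j x => (N j x)%:R / n%:R).
    by apply: eq_bigr => j _; apply: eq_bigr => x _; rewrite (eqP (forallP (hQ j) x)).
  apply: le_trans (l1_dist_triangle _ q _) _.
  have : l1_dist q (fun j x => (N j x)%:R / n%:R) <= (r * K)%:R * e'.
    by apply: l1_dist_le => j x; rewrite distrC ltW // scale.
  have : ((r * K)%:R + 1) * e' <= eps - l1_dist p q.
    rewrite mulrC -ler_pdivlMr ?ltr_wpDl //; last by rewrite ge_min lexx orbT.
  lra.
have mean0 : 0 < mean_models eps n.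
  by rewrite divr_gt0 ?factX_gt0 // ltr0n (leq_trans Z0).
split=> //.
have : ln (#|models n N|%:R / n`!%:R ^+ r) <= ln (mean_models eps n).
  rewrite ler_ln ?posrE ?divr_gt0 ?factX_gt0 ?ltr0n ?(leq_trans Z0) //.
  by rewrite ler_pM2r ?invr_gt0 ?factX_gt0 // ler_nat.
have small : @log_error R r A * (1 + ln n.+1%:R) <= d / 2 * n%:R.
  by near: n; exact: log_little_o.
move: lnZ hF; rewrite !ler_norml => /andP[h1 _] /andP[h2 _] h3.
have := ler_wpM2l (ltW nR) h2; lra.
Unshelve. all: by end_near. Qed.

(** The supremum may be approached only on the boundary of the [eps]-ball;
    mixing with [p], the centre, gives interior points with almost the same value
    of [F]. *)
Lemma mean_models_lower_max eps d : 0 < eps -> 0 < d ->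
  \forall n \near \oo, 0 < mean_models eps n /\
    n%:R * (max_F eps - d) <= ln (mean_models eps n).
Proof.
move=> e0 d0; have d30 : 0 < d / 3 by rewrite divr_gt0.
have [_ [[c q] [/= cq dq] <-] /= hF] := sup_adherent d30 (has_sup_F (ltW e0)).
have [e' e'0 he] := F_value_continuous r0 cq d30.
have [c01 q01] := coupling_family_le1 r0 cq.
have [m01 p01] := coupling_family_le1 r0 mp.
(* Coordinates lie in [0, 1], so mixing with weight t < e' moves them by less
   than e'. *)
pose t : R := Num.min (1 / 2) (e' / 2).
have t0 : 0 < t by rewrite lt_min !divr_gt0.
have t1 : t <= 1 / 2 by rewrite ge_min lexx.
have te : t < e'.
  have : t <= e' / 2 by rewrite ge_min lexx orbT.
  lra.
have t01 : 0 <= t <= 1 by rewrite (ltW t0) /=; lra.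
have near_t (x y : R) : 0 <= x <= 1 -> 0 <= y <= 1 ->
    `|(1 - t) * x + t * y - x| < e'.
  move=> x01 y01; have -> : (1 - t) * x + t * y - x = t * (y - x) by ring.
  apply: le_lt_trans te; rewrite normrM (gtr0_norm t0) ler_piMr ?(ltW t0) //.
  by rewrite ler_norml; lra.
have := he _ _ (fun a => near_t _ _ (c01 a) (m01 a))
  (fun j x => near_t _ _ (q01 j x) (p01 j x)).
rewrite ler_norml => /andP[hF' _].
have lt_eps : l1_dist p (fun j x => (1 - t) * q j x + t * p j x) < eps.
  rewrite l1_dist_mixl //; have : 0 < t * eps by rewrite mulr_gt0.
  have : (1 - t) * l1_dist p q <= (1 - t) * eps by rewrite ler_wpM2l //; lra.
  lra.
have := mean_models_lower (coupling_family_mix t01 cq mp) lt_eps d30.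
apply: filterS => n [h1 h2]; split=> //; apply: le_trans h2.
rewrite ler_wpM2l //; rewrite /max_F; lra.
Qed.

Lemma mean_models_cvg eps : 0 < eps ->
  ((n%:R^-1)%:E * lne (mean_models eps n)%:E)%E @[n --> \oo] --> (max_F eps)%:E.
Proof.
move=> e0.
have pos : \forall n \near \oo, 0 < mean_models eps n.
  by apply: filterS (mean_models_lower_max e0 ltr01) => n [].
apply: (@cvg_trans _ ((EFin (n%:R^-1 * ln (mean_models eps n))) @[n --> \oo])).
  apply: near_eq_cvg; near=> n; rewrite lne_EFin //; near: n; exact: pos.
apply: cvg_EFin; first by near=> n.
apply/cvgrPdist_le => d d0; near=> n => /=.
have n0 : (0 < n)%N by near: n; exact: nbhs_infty_gt.
have nR : 0 < n%:R :> R by rewrite ltr0n.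
have [mean0 lower] : 0 < mean_models eps n /\
    n%:R * (max_F eps - d) <= ln (mean_models eps n).
  by near: n; exact: mean_models_lower_max.
have upper := mean_models_upper (ltW e0) n0 mean0.
have small : (@log_error R r A + r%:R * #|{: A * A}|%:R) * (1 + ln n.+1%:R) <= d * n%:R.
  by near: n; exact: log_little_o.
have E : ln (mean_models eps n) = n%:R * (n%:R^-1 * ln (mean_models eps n)).
  by rewrite mulVKf // lt0r_neq0.
rewrite ler_norml -(ler_pM2l nR) -[X in _ && X](ler_pM2l nR).
by apply/andP; split; lra.
Unshelve. all: by end_near. Qed.

(** The value at the centre is a lower bound for all suprema, and is approached
    as the ball shrinks because both the couplings and their margins are
    controlled by the distance. *)
Lemma inf_max_F :
  ereal_inf [set (max_F eps)%:E | eps in [set eps | 0 < eps]] = (F_value m p)%:E.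
Proof.
apply/eqP; rewrite eq_le; apply/andP; split; last first.
  apply/ereal_infP => _ [eps /= e0 <-]; rewrite lee_fin.
  by apply: (@F_value_le_max eps (m, p)); [|apply: near_couplings_refl]; apply: ltW.
apply/lee_addgt0Pr => d d0.
have [e e0 he] := F_value_continuous r0 mp d0.
apply: (@le_trans _ _ (max_F (e / 2))%:E).
  by apply: ge_ereal_inf; exists (max_F (e / 2))%:E => //; exists (e / 2) => //=; rewrite divr_gt0.
rewrite lee_fin; apply: ge_sup.
  by have [] := @has_sup_F (e / 2); rewrite // divr_ge0 // ltW.
move=> _ [[c q] [/= cq dq] <-].
have e2 : e / 2 < e by lra.
have := he c q; rewrite ler_norml => /(_ _ _)/andP[].
- move=> a; apply: le_lt_trans e2; apply: le_trans dq; rewrite distrC.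
  exact: (marginal_dist_le (Ordinal r0) mp cq).
- move=> j x; apply: le_lt_trans e2; apply: le_trans dq; rewrite distrC.
  exact: coord_le_l1_dist.
- by move=> _; lra.
Qed.

End limit.

(** * Homomorphisms from the free group or semigroup *)

Section free_homs.
Variables (r : nat) (G : monoidType) (s : 'I_r -> G).
Hypothesis hG : free_group_on s \/ free_semigroup_on s.

(** The product of permutations composes from left to right, so [sigma] is an
    anti-homomorphism for it, and the universal property applies to
    [g |-> (sigma g)^-1]. *)
Lemma sym_hom_ext n (f : 'I_r -> {perm 'I_n}) :
  exists sigma : G -> {perm 'I_n}, [/\ sym_hom sigma, forall i, sigma (s i) = f i &
    forall sigma', sym_hom sigma' -> (forall i, sigma' (s i) = f i) -> sigma' = sigma].
Proof.
have [h [[[h1 hM] hs] huniq]] : exists! h : G -> {perm 'I_n},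
    monoid.monoid_morphism h /\ (forall i, h (s i) = (f i)^-1)%g.
  by case: hG => [[_ /(_ {perm 'I_n})]|/(_ {perm 'I_n})]; apply.
exists (fun g => (h g)^-1)%g; split=> [|i|sigma' [s1 sM] ss].
- split=> [j|g1 g2 j]; first by rewrite h1 invg1 perm1.
  by rewrite hM invMg permM.
- by rewrite hs invgK.
- apply/funext => g; apply: invg_inj; rewrite invgK.
  have <- // : (fun g => (sigma' g)^-1)%g = h; apply/esym/huniq; split.
    split; first apply/permP => j.
      by apply: (@perm_inj _ (sigma' 1%g)); rewrite permKV perm1 s1.
    move=> g1 g2; rewrite -invMg; congr (_^-1)%g.
    by apply/permP => j; rewrite permM sM.
  by move=> i; rewrite ss.
Qed.

Lemma sym_hom_enum n : exists Phi : {ffun 'I_r -> {perm 'I_n}} -> G -> {perm 'I_n},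
  [/\ forall f, sym_hom (Phi f), forall f i, Phi f (s i) = f i &
   forall (R : realType) (F : (G -> {perm 'I_n}) -> R),
    expect_sym_hom F = (\sum_f F (Phi f)) / n`!%:R ^+ r].
Proof.
have [Phi hPhi] := choice (fun f : {ffun 'I_r -> {perm 'I_n}} => sym_hom_ext f).
exists Phi; split=> [f|f i|R F]; [by case: (hPhi f) | by case: (hPhi f) |].
have Phi_inj : injective Phi.
  move=> f f' E; apply/ffunP => i.
  by have [_ <- _] := hPhi f; have [_ <- _] := hPhi f'; rewrite E.
(* Homomorphisms correspond to their values on the generators. *)
have homsE : [set sigma : G -> {perm 'I_n} | sym_hom sigma] = range Phi.
  apply/seteqP; split=> [sigma hsigma|_ [f _ <-]]; last by case: (hPhi f).
  exists [ffun i => sigma (s i)] => //; apply/esym.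
  by have [_ _] := hPhi [ffun i => sigma (s i)]; apply=> // i; rewrite ffunE.
rewrite /expect_sym_hom homsE.
have E : perm_eq (fset_set (range Phi))
    [seq Phi f | f <- index_enum {ffun 'I_r -> {perm 'I_n}}].
  apply: uniq_perm; first exact: fset_uniq.
    by rewrite (map_inj_uniq Phi_inj) index_enum_uniq.
  move=> sigma; rewrite in_fset_set; last by apply: finite_image; exact: finite_finset.
  apply/idP/mapP => [|[f _ ->]]; last by rewrite inE; exists f.
  by rewrite inE => -[f _ <-]; exists f => //; rewrite mem_index_enum.
rewrite (perm_big _ E) big_map; congr (_ / _).
rewrite (perm_size E) size_map -natrX; congr (_%:R).
rewrite -sum1_size -(card_Sn n) -[r in RHS]card_ord -card_ffun -sum1_card.
exact: eq_bigl.
Qed.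

(** Otherwise the index set [{1, s i}] of the pair statistics would collapse to a
    single point. *)
Lemma free_generator_neq1 i : s i != 1%g.
Proof.
have [sigma [[s1 _] hs _]] := @sym_hom_ext 2 (fun=> tperm ord0 ord_max).
apply/eqP => si; have := s1 ord0; rewrite -si hs tpermL.
by move/(congr1 val).
Qed.

End free_homs.


(** * Entropy of finite measurable families *)

Section finite_families.
Context {R : realType} {d : measure_display} {X : measurableType d}.
Variable mu : probability X R.

Lemma fsbig_finType (V : nmodType) (I : finType) (f : I -> V) :
  \sum_(i \in [set: I]) f i = \sum_i f i.
Proof.
rewrite [RHS]fsbig_seq ?index_enum_uniq //; apply: eq_fsbigl.
by apply/seteqP; split=> i //= _; rewrite mem_index_enum.
Qed.

Lemma mu_fiber_sum (B : finType) (f : X -> B) (D : set X) :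
  measurable D -> (forall b, measurable (f @^-1` [set b])) ->
  fine (mu D) = \sum_b fine (mu (D `&` f @^-1` [set b])).
Proof.
move=> mD mf; have {1}-> : D = \bigcup_(b in [set: B]) (D `&` f @^-1` [set b]).
  by apply/seteqP; split=> [x Dx|x [b _ []] //]; exists (f x).
rewrite measure_fin_bigcup; first last.
- by move=> b _; apply: measurableI.
- by move=> b b' _ _ [x [[_ <-] [_ <-]]].
- exact: finite_finset.
rewrite fsbig_finType -[RHS]/(fine (\sum_b fine (mu (D `&` f @^-1` [set b])))%:E).
rewrite -sumEFin; congr fine; apply: eq_bigr => b _.
by rewrite fineK // fin_num_measure //; apply: measurableI.
Qed.

Lemma xlogx_neg_mu_ge0 (D : set X) : measurable D -> 0 <= xlogx_neg (fine (mu D)).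
Proof.
move=> mD; apply: xlogx_neg_ge0; rewrite fine_ge0 //= -lee_fin fineK ?fin_num_measure //.
exact: probability_le1.
Qed.

(** The entropy sums over the set of cells and not over the family. Disjointness
    allows only empty cells to be repeated, and these contribute nothing. *)
Lemma entropy_finite_family (I : finType) (f : I -> set X) :
  (forall i, measurable (f i)) -> trivIset setT f ->
  entropy mu (range f) = (\sum_i xlogx_neg (fine (mu (f i))))%:E.
Proof.
move=> mf tf; rewrite /entropy esum_fset; first last.
- by move=> P; rewrite inE => -[i _ <-]; rewrite lee_fin xlogx_neg_mu_ge0.
- by apply: finite_image; exact: finite_finset.
pose D := [set i | f i !=set0].
have g0 : - (fine (mu set0) * ln (fine (mu set0))) = 0 by rewrite measure0 /= mul0r oppr0.
transitivity (\sum_(P \in f @` D) (- (fine (mu P) * ln (fine (mu P))))%:E)%R.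
  apply/esym/fsbig_widen => [_ [i _ <-]|_ [[i _ <-] nD]] /=; first by exists i.
  have [->|/set0P fi] := eqVneq (f i) set0; first by rewrite g0.
  by case: nD; exists i.
rewrite fsbig_image; last first.
  move=> i j; rewrite !inE /= => -[x fix_] _ E.
  by apply: (tf i j) => //; exists x; split=> //; rewrite -E.
transitivity (\sum_(i \in [set: I]) (xlogx_neg (fine (mu (f i))))%:E)%R.
  apply: fsbig_widen => // i [_ /= nD]; rewrite /xlogx_neg.
  by have [->|/set0P //] := eqVneq (f i) set0; rewrite g0.
by rewrite fsbig_finType sumEFin.
Qed.

End finite_families.

(** * Laws of an observable and of its models *)

Section observable_statistics.
Context {R : realType} {d : measure_display} {X : measurableType d}.
Variable mu : probability X R.
Variables (r : nat) (G : monoidType) (s : 'I_r -> G) (T : G -> X -> X).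
Hypothesis hT : mp_action mu T.
Variables (A : finType) (phi : X -> A).
Hypothesis hphi : observable phi.

Definition marginal_law (a : A) : R := fine (mu (phi @^-1` [set a])).

Definition pair_cell (j : 'I_r) (x : A * A) : set X :=
  phi @^-1` [set x.1] `&` T (s j) @^-1` (phi @^-1` [set x.2]).

Definition pair_law (j : 'I_r) (x : A * A) : R := fine (mu (pair_cell j x)).

Lemma measurable_shifted_fiber g a : measurable (T g @^-1` (phi @^-1` [set a])).
Proof. by case: hT => mpT _ _; rewrite -[X in measurable X]setTI; apply: (mpT g).1. Qed.

Lemma measurable_pair_cell j x : measurable (pair_cell j x).
Proof. by apply: measurableI => //; apply: measurable_shifted_fiber. Qed.

Lemma observable_coupling_family : coupling_family marginal_law pair_law.
Proof.
split=> [j x||j a|j b].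
- by rewrite fine_ge0.
- have := @mu_fiber_sum _ _ _ mu A phi setT measurableT (fun b => hphi [set b]).
  by rewrite probability_setT /= => ->; apply: eq_bigr => a _; rewrite setTI.
- rewrite /marginal_law (mu_fiber_sum mu (f := phi \o T (s j))) // => b.
  exact: measurable_shifted_fiber.
- case: hT => mpT _ _; rewrite /marginal_law -((mpT (s j)).2 _ (hphi [set b])).
  rewrite (mu_fiber_sum mu (f := phi)) //; last exact: measurable_shifted_fiber.
  by apply: eq_bigr => a _; rewrite setIC.
Qed.

Lemma F_observableE :
  F_observable mu s T phi = (F_value marginal_law pair_law)%:E.
Proof.
rewrite /F_observable /F_partition /F_value [RHS]EFinD [in RHS]EFinM.
congr (_ * _ + _)%E; last rewrite -sumEFin.
  apply: entropy_finite_family => //.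
  by move=> a b _ _ [x [/= <- <-]].
apply: eq_bigr => j _.
have -> : pjoin (observable_partition phi) (ppreimage (T (s j)) (observable_partition phi))
    = range (pair_cell j).
  apply/seteqP; split=> [_ [_ [a _ <-] [_ [_ [b _ <-] <-] <-]]|_ [[a b] _ <-]].
    by exists (a, b).
  exists (phi @^-1` [set a]); first by exists a.
  exists (T (s j) @^-1` (phi @^-1` [set b])) => //.
  by exists (phi @^-1` [set b]) => //; exists b.
apply: entropy_finite_family => [x|]; first exact: measurable_pair_cell.
by move=> [a b] [a' b'] _ _ [x [[/= <- <-] [/= <- <-]]].
Qed.

(** A name indexed by [{1, s j}] is a pair of letters, as [1] and [s j] are
    distinct. *)
Lemma dist_starE n (sigma : G -> {perm 'I_n}) (psi : 'I_n -> A) :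
  (forall j, s j != 1%g) -> sym_hom sigma ->
  dist_star mu T phi s sigma psi =
  l1_dist pair_law (fun j x => (joint_count psi (psi \o sigma (s j)) x)%:R / n%:R).
Proof.
move=> s1 [sigma1 _]; case: hT => _ T1 _.
apply: eq_bigr => j _; set H := [fset _; _]%fset.
pose e0 : H := FSetSub (fset21 1%g (s j)); pose e1 : H := FSetSub (fset22 1%g (s j)).
have eP (k : H) : k = e0 \/ k = e1.
  by have /fset2P[E|E] := fsvalP k; [left | right]; apply: val_inj.
pose h (x : A * A) : {ffun H -> A} := [ffun k => if val k == 1%g then x.1 else x.2].
have h0 x : h x e0 = x.1 by rewrite ffunE eqxx.
have h1 x : h x e1 = x.2 by rewrite ffunE (negbTE (s1 j)).
rewrite /dist (reindex h); last first.
  exists (fun a : {ffun H -> A} => (a e0, a e1)) => [[a b] _|a _]; first by rewrite h0 h1.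
  by apply/ffunP => k; case: (eP k) => ->; rewrite ?h0 ?h1.
apply: eq_bigr => x _; congr (`|fine (mu _) - _%:R / _|).
  apply/seteqP; split=> y /=.
    move=> /ffunP E; have := E e0; have := E e1.
    by rewrite h0 h1 !ffunE /= T1.
  case=> /= E0 E1; apply/ffunP => k; case: (eP k) => ->.
    by rewrite h0 ffunE /= T1.
  by rewrite h1 ffunE.
apply: eq_card => k; rewrite !inE; apply/eqP/eqP => [/ffunP E|E].
  have := E e0; have := E e1; rewrite h0 h1 !ffunE /= sigma1 => E1 E0.
  by rewrite [RHS]surjective_pairing -E0 -E1.
apply/ffunP => i; case: (eP i) => ->; rewrite ?h0 ?h1 ffunE -E //=.
by rewrite sigma1.
Qed.

(** Exchanging the order of counting: for all homomorphisms the models are counted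
    together, as pairs of a name and a tuple of permutations. *)
Lemma growth_rateE (hG : free_group_on s \/ free_semigroup_on s) eps n :
  growth_rate mu T phi s eps n =
  ((n%:R^-1)%:E * lne (mean_models pair_law eps n)%:E)%E.
Proof.
congr (_ * lne _%:E)%E; have [Phi [hPhi Phis ->]] := sym_hom_enum hG n.
congr (_ / _); rewrite -natr_sum; congr _%:R.
rewrite -sum1_card (partition_big snd predT) //=; apply: eq_bigr => f _.
rewrite /num_models -sum1_card.
rewrite [RHS](reindex_onto (fun psi => (psi, f)) fst) /=; last first.
  by case=> psi f' /= /andP[_ /eqP ->].
apply: eq_bigl => psi; rewrite !inE /= !eqxx !andbT.
rewrite dist_starE //; last exact: free_generator_neq1.
by congr (_ <= _); apply: eq_bigr => j _; rewrite Phis.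
Qed.

End observable_statistics.

Theorem theorem1p4 (R : realType) (d : measure_display) (X : measurableType d)
    (mu : probability X R) (hX : standard_borel R X)
    (r : nat) (hr : (1 <= r)%N)
    (G : monoidType) (s : 'I_r -> G)
    (hG : free_group_on s \/ free_semigroup_on s)
    (T : G -> X -> X) (hT : mp_action mu T)
    (A : finType) (phi : X -> A) (hphi : observable phi) :
  (forall eps : R, 0 < eps -> cvgn (growth_rate mu T phi s eps)) /\
  F_observable mu s T phi =
    ereal_inf [set limn (growth_rate mu T phi s eps) | eps in [set eps : R | 0 < eps]].
Proof.
have mp := observable_coupling_family s hT hphi.
have cvg eps : 0 < eps -> growth_rate mu T phi s eps @ \oo -->
    (max_F (pair_law mu s T phi) eps)%:E.
  move=> e0; have := mean_models_cvg hr mp e0.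
  have -> // : growth_rate mu T phi s eps = fun n =>
      ((n%:R^-1)%:E * lne (mean_models (pair_law mu s T phi) eps n)%:E)%E.
  by apply/funext => n; apply: growth_rateE.
split=> [eps e0|]; first by apply/cvg_ex; eexists; exact: cvg.
rewrite (F_observableE s hT hphi) -(inf_max_F hr mp); congr ereal_inf.
by apply/seteqP; split=> _ [eps e0 <-]; exists eps => //; rewrite (cvg_lim _ (cvg _ e0)).
Qed.
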